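(* The degree polynomial $D(H_n;x)$ of the anti-regular graph $H_n$ has exactly one negative root, which lies in the interval $[-2,-1/2)$. The limits of the roots of the degree polynomials $D(H_n;x)$, as $n\to\infty$, are $0$ and the unit circle $|z|=1$ centered at $z=0$.
   Context: The degree polynomial of a finite graph $G$ with vertex set $V$ is $D(G;x)=\sum_{v\in V} x^{\deg(v)}$. For $n\ge 2$, the connected anti-regular graph $H_n$ is the simple graph with vertices $v_1,\ldots,v_n$ in which distinct vertices $v_i,v_j$ are adjacent if and only if $i+j\geq n+1$. Its degrees are $1,2,\ldots,n-1$, each occurring exactly once except $\lfloor n/2\rfloor$, which occurs twice, so $D(H_n;x)=\sum_{i=1}^{n-1}x^i+x^{\lfloor n/2\rfloor}$. A complex number $z$ is a limit of roots (limit of zeros) of a sequence of polynomials $(P_n)$ if there is a sequence $(z_n)$ of complex numbers with $P_n(z_n)=0$ for all $n$ and $\lim_{n\to\infty} z_n=z$.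
   Formalization: The claim of exactly one negative root in [-2,-1/2) is stated only for n not congruent to 2 mod 4, since for n congruent to 2 mod 4 (e.g. D(H_2;x)=2x) there is no negative root; roots are counted without multiplicity. *)

(* Defs.v *)
From HB Require Import structures.
From mathcomp Require Import all_boot all_order all_algebra.
From mathcomp Require Import zify ring lra.
From mathcomp Require Import all_classical all_reals all_analysis.
From mathcomp.real_closed Require Export complex.

Set Implicit Arguments.
Unset Strict Implicit.
Unset Printing Implicit Defensive.

Import Order.TTheory GRing.Theory Num.Theory numFieldNormedType.Exports.

Local Open Scope ring_scope.

Record sgraph := SGraph {
  vertex : finType;
  adj : rel vertex;
  adj_sym : symmetric adj;
  adj_irrefl : irreflexive adj
}.

Definition degree (G : sgraph) (v : vertex G) : nat :=
  #|[set w : vertex G | adj v w]|.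

Definition degree_poly (K : nzRingType) (G : sgraph) : {poly K} :=
  \sum_(v : vertex G) 'X^(degree v).

(* The vertex [v_k], [1 <= k <= n], is the ordinal of value [k - 1]. *)
Definition antiregular_adj (n : nat) : rel 'I_n :=
  fun i j => (i != j) && (n.+1 <= i.+1 + j.+1)%N.

Lemma antiregular_adj_sym n : symmetric (@antiregular_adj n).
Proof. by move=> i j; rewrite /antiregular_adj eq_sym addnC. Qed.

Lemma antiregular_adj_irrefl n : irreflexive (@antiregular_adj n).
Proof. by move=> i; rewrite /antiregular_adj eqxx. Qed.

Definition antiregular (n : nat) : sgraph :=
  SGraph (@antiregular_adj_sym n) (@antiregular_adj_irrefl n).

(* Convergence is for the metric [`|x - y|] of [C]; this is the usual topology
   of the complex numbers when [C] is [R[i]] with [R : realType]. *)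
Definition is_limit_of_roots (C : numFieldType) (P : nat -> {poly C}) (z : C) :
    Prop :=
  exists z_ : nat -> C,
    (forall n, root (P n) (z_ n)) /\ (z_ @ \oo --> z)%classic.

Lemma degree_antiregular n (i : 'I_n) :
  degree (i : vertex (antiregular n)) = if (i < n./2)%N then i.+1 else i.
Proof.
rewrite /degree /antiregular /antiregular_adj /= cardsE -sum1_card.
rewrite [LHS](_ : _ = \sum_(j < n | (j != i :> nat) && (n <= i + j + 1)) 1)%N;
  last first.
  apply: eq_bigl => j; rewrite unfold_in /= -val_eqE /= eq_sym.
  by congr andb; lia.
rewrite -(big_mkord (fun j => (j != i) && (n <= i + j + 1))%N (fun=> 1%N)).
have lt_in := ltn_ord i.
rewrite (@big_cat_nat _ _ _ (n - i.+1)%N) //=; last by lia.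
rewrite big_nat_cond big_pred0 ?add0n; last by move=> j; lia.
rewrite big_nat_cond.
have E : (\sum_(n - i.+1 <= j < n) 1 = i.+1)%N by rewrite sum_nat_const_nat; lia.
case: ifP => hi.
  rewrite (eq_bigl (fun j => (n - i.+1 <= j < n) && true)%N).
    by rewrite -big_nat_cond E.
  by move=> j; lia.
rewrite (eq_bigl (fun j => (n - i.+1 <= j < n) && (j != i))%N); last first.
  by move=> j; lia.
move: E; rewrite (bigD1_seq (nat_of_ord i)) ?iota_uniq ?mem_index_iota //=;
  last by lia.
by rewrite big_nat_cond => -[].
Qed.

Lemma degree_poly_antiregular (K : nzRingType) (n : nat) : (2 <= n)%N ->
  degree_poly K (antiregular n) = \sum_(1 <= i < n) 'X^i + 'X^(n./2).
Proof.
move=> n2; rewrite /degree_poly.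
under eq_bigr do rewrite degree_antiregular.
rewrite -(big_mkord xpredT (fun i => 'X^(if (i < n./2)%N then i.+1 else i))).
rewrite (@big_cat_nat _ _ _ n./2) //=; last by lia.
rewrite (eq_big_nat _ _ (F2 := fun i => 'X^(i.+1))); last first.
  by move=> i /andP[_ ->].
rewrite [X in _ + X](eq_big_nat _ _ (F2 := fun i => 'X^i)); last first.
  by move=> i /andP[]; rewrite leqNgt => /negbTE->.
rewrite [in RHS](@big_cat_nat _ _ _ n./2) //=; [|lia|lia].
rewrite addrAC; congr (_ + _).
rewrite -(big_add1 _ _ 0%N n./2.+1 xpredT (fun i => 'X^i)).
by rewrite big_nat_recr //=; lia.
Qed.

(* When [n = 2 %[mod 4]] the polynomial has no negative root at all; for
   instance [D(H_2; x) = 2x] and [D(H_6; x) = x (x^2 + 1) (x^2 + x + 1)]. *)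
Lemma degree_poly_antiregular_no_neg_root (R : realFieldType) (n : nat) (x : R) :
  (n %% 4 = 2)%N -> x < 0 -> ~~ root (degree_poly R (antiregular n)) x.
Proof.
move=> n4 x0; rewrite degree_poly_antiregular; last by lia.
have [k ->] : exists k, n = (k.*2.+1).*2 by exists (n %/ 4)%N; lia.
rewrite doubleK rootE hornerD hornerXn horner_sum.
under eq_bigr do rewrite hornerXn.
have xk0 : 0 <= x ^+ k.*2 by rewrite -mul2n exprM exprn_ge0 // sqr_ge0.
have geo : (x - 1) * (\sum_(1 <= i < (k.*2.+1).*2) x ^+ i) =
    x * (x * x ^+ k.*2 * x ^+ k.*2 - 1).
  rewrite doubleS big_add1 /= big_mkord; under eq_bigr do rewrite exprS.
  rewrite -mulr_sumr mulrCA -subrX1.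
  by rewrite -addnn exprS exprD mulrA.
apply/eqP => D0; have := congr1 ( *%R (x - 1)) D0.
rewrite mulrDr geo mulr0 exprS => E0.
have : x * ((x * x ^+ k.*2 - 1) * (x ^+ k.*2 + 1)) = 0 by rewrite -E0; ring.
have : x * x ^+ k.*2 <= 0 by rewrite nmulr_rle0.
move=> h /eqP; rewrite !mulf_eq0 => /or3P[] /eqP; lra.
Qed.

(* Main.v *)
Require Import Defs.
From HB Require Import structures.
From mathcomp Require Import all_boot all_order all_algebra.
From mathcomp Require Import all_classical all_reals all_analysis.
From mathcomp Require Import zify ring lra.
Import Order.TTheory GRing.Theory Num.Theory numFieldNormedType.Exports.
Local Open Scope ring_scope.

(** Write D for the degree polynomial of the anti-regular graph on n vertices
    and m for the integer part of n / 2.  Summing the geometric progression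
    gives

      (x - 1) D(x) = x^n - x + (x - 1) x^m,

    and everything is read off this formula.

    Negative root.  If n = 2k, the right-hand side is (x^k - 1) (x^k + x), so
    for even k the only negative root is -1.  If n = 2k + 1, the substitution
    t = -x (k even) or t = -1/x (k odd) turns the equation for x < 0 into
    t^a + t^b + t^c = 1 with t > 0.  The left-hand side is increasing, is at
    most 1 at 1/2 and is at least 1 at 1, so there is exactly one solution, and
    it lies in [1/2, 1] ([expr_sum3_inj], [expr_sum3_eq1]).

    Limits lie in {0} or on the circle.  For n = 2k the same factorization
    shows that every complex root is 0 or has modulus exactly 1; the even
    indices alone therefore confine the limits.

    Every point w of the circle is a limit.  This is a discrete form of the
    following potential-theoretic fact: for fixed x neither 0
    nor on the circle, (1/n) log |D(x)| tends to max(0, log |x|), which is not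
    harmonic across the circle, so the roots must accumulate at each of its
    points.  Concretely, if P has no root
    within e of c, then factoring P and using
    (c - r + h) (c - r - h) = (c - r)^2 - h^2 for each root r gives

      |P(c + h)| |P(c - h)| <= |P(c)|^2 (1 + |h|^2 / e^2)^(deg P)

    ([two_point_root_bound]).  Take c = (1 - t) w just inside the circle and
    h = 2 t w.  Then D(c) is bounded in n, D(c - h) is bounded away from 0
    since c - h is inside the disc, and D(c + h) grows like (1 + t)^n since
    c + h is outside.  The growth rate on the left is linear in t but the one
    on the right is quadratic in t, a contradiction once t is small compared
    with e^2 and n is large.  So for all large n there is a root near w
    ([antiregular_root_near]), and the roots nearest to w converge to w. *)

(** * The degree polynomial in closed form *)

Lemma horner_degree_poly_antiregular (K : comNzRingType) (n : nat) (x : K) :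
  (2 <= n)%N ->
  (x - 1) * (degree_poly K (antiregular n)).[x] =
    x ^+ n - x + (x - 1) * x ^+ n./2.
Proof.
move=> n2; rewrite degree_poly_antiregular // hornerD hornerXn mulrDr.
congr (_ + _); rewrite horner_sum mulr_sumr.
rewrite (telescope_sumr_eq (fun i => x ^+ i)) ?expr1 //; first by lia.
by move=> i _; rewrite hornerXn mulrBl mul1r -exprS.
Qed.

Lemma root_degree_poly_antiregular (K : idomainType) (n : nat) (x : K) :
  (2 <= n)%N -> x != 1 ->
  root (degree_poly K (antiregular n)) x =
    (x ^+ n - x + (x - 1) * x ^+ n./2 == 0).
Proof.
move=> n2 x1; rewrite rootE -horner_degree_poly_antiregular // mulf_eq0.
by rewrite subr_eq0 (negPf x1).
Qed.

Lemma antiregular_even_factor (K : comPzRingType) (k : nat) (x : K) :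
  x ^+ k.*2 - x + (x - 1) * x ^+ k = (x ^+ k - 1) * (x ^+ k + x).
Proof. by rewrite -addnn exprD; ring. Qed.

(** * The negative root *)

Lemma expr_sum3_inj (R : realDomainType) (a b c : nat) (s t : R) :
  (0 < a)%N -> 0 <= s -> 0 <= t ->
  s ^+ a + s ^+ b + s ^+ c = t ^+ a + t ^+ b + t ^+ c -> s = t.
Proof.
wlog st : s t / s <= t.
  move=> H a0 s0 t0 E; have [st|/ltW ts] := leP s t; first exact: H.
  by apply/esym/H.
move=> a0 s0 t0 E; apply/eqP; rewrite eq_le st leNgt; apply/negP => lt_st.
have Ha : s ^+ a < t ^+ a by rewrite ltr_pXn2r // ?nnegrE; lia.
have Hb : s ^+ b <= t ^+ b by rewrite lerXn2r.
have Hc : s ^+ c <= t ^+ c by rewrite lerXn2r.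
by have := ltr_leD (ltr_leD Ha Hb) Hc; rewrite E ltxx.
Qed.

(** The intermediate value theorem applies because the sum is 3 at 1. *)
Lemma expr_sum3_eq1 (R : rcfType) (a b c : nat) :
  (2^-1 : R) ^+ a + 2^-1 ^+ b + 2^-1 ^+ c <= 1 ->
  exists2 t : R, 2^-1 <= t <= 1 & t ^+ a + t ^+ b + t ^+ c = 1.
Proof.
move=> h; have := @poly_ivt R ('X^a + 'X^b + 'X^c - 1) 2^-1 1.
case=> [||t t01].
- by lra.
- by rewrite !hornerE !expr1n; apply/andP; split; lra.
- by rewrite rootE !hornerE subr_eq0 => /eqP; exists t.
Qed.

(** For even k the factors x^k - 1 and x^k + x both vanish at -1 and at no other
    negative number. *)
Lemma neg_root_antiregular_double (R : rcfType) (k : nat) (x : R) :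
  (0 < k)%N -> ~~ odd k -> x < 0 ->
  root (degree_poly R (antiregular k.*2)) x = (x == - 1).
Proof.
move=> k0 ek x0; rewrite root_degree_poly_antiregular; [|lia|lra].
rewrite doubleK antiregular_even_factor mulf_eq0 subr_eq0.
have -> : (x == - 1) = (- x == 1) by rewrite eqr_oppLR.
have Hx : x ^+ k = (- x) ^+ k by rewrite exprNn -signr_odd (negbTE ek) mul1r.
have -> : x ^+ k + x = - x * ((- x) ^+ k.-1 - 1).
  by rewrite mulrBr -exprS prednK // Hx; ring.
rewrite Hx mulf_eq0 subr_eq0 oppr_eq0 (lt_eqF x0) /=.
have x0' : 0 <= - x by lra.
rewrite pexpr_eq1 //.
by rewrite pexpr_eq1 ?orbb //; lia.
Qed.

(** For even k the powers with exponents 2k and k ignore the sign, and the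
    closed form becomes -t (t^(2k) + t^k + t^(k-1) - 1) with t = -x. *)
Lemma neg_root_antiregular_double1_even (R : rcfType) (k : nat) (x : R) :
  (0 < k)%N -> ~~ odd k -> x < 0 ->
  root (degree_poly R (antiregular k.*2.+1)) x =
    ((- x) ^+ k.*2 + (- x) ^+ k + (- x) ^+ k.-1 == 1).
Proof.
move=> k0 ek x0; rewrite root_degree_poly_antiregular; [|lia|lra].
have -> : (k.*2.+1)./2 = k by lia.
have x1 : x = - (- x) by rewrite opprK.
rewrite -[in RHS]subr_eq0; set y := - x in x1 *.
have -> : x ^+ k.*2.+1 - x + (x - 1) * x ^+ k =
    - y * (y ^+ k.*2 + y ^+ k + y ^+ k.-1 - 1).
  have Hx i : ~~ odd i -> x ^+ i = y ^+ i.
    by move=> ei; rewrite x1 exprNn -signr_odd (negbTE ei) mul1r.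
  have Ey : y ^+ k = y * y ^+ k.-1 by rewrite -exprS prednK.
  by rewrite exprS !Hx ?odd_double // x1 Ey; ring.
by rewrite mulf_eq0 -x1 (lt_eqF x0).
Qed.

(** For odd k the terms of the equation in -x have mixed signs; dividing by the
    leading power, that is passing to t = -1/x, gives all variable terms the
    same sign again. *)
Lemma neg_root_antiregular_double1_odd (R : rcfType) (k : nat) (x : R) :
  odd k -> x < 0 ->
  root (degree_poly R (antiregular k.*2.+1)) x =
    ((- x^-1) ^+ k.*2 + (- x^-1) ^+ k.+1 + (- x^-1) ^+ k == 1).
Proof.
move=> ok x0; rewrite root_degree_poly_antiregular; [|lia|lra].
have -> : (k.*2.+1)./2 = k by lia.
have xn0 : x != 0 by rewrite lt_eqF.
have y0 : - x^-1 != 0 by rewrite oppr_eq0 invr_eq0.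
have x1 : x = - (- x^-1)^-1 by rewrite invrN opprK invrK.
rewrite -[in RHS]subr_eq0; set y := - x^-1 in x1 y0 *.
have -> : x ^+ k.*2.+1 - x + (x - 1) * x ^+ k =
    (y ^+ k.*2 + y ^+ k.+1 + y ^+ k - 1) / y ^+ k.*2.+1.
  have Hx : x ^+ k = - (y ^+ k)^-1.
    by rewrite x1 exprNn -signr_odd ok mulN1r exprVn.
  rewrite -addnn !exprS !exprD Hx x1.
  have yk0 : y ^+ k != 0 by rewrite expf_neq0.
  by field; rewrite yk0 y0.
by rewrite mulf_eq0 invr_eq0 expf_eq0 (negPf y0) andbF orbF.
Qed.

(** The end points of [-2, -1/2) come from t in [1/2, 1]: the value -2 is
    reached at t = 1/2 with t = -1/x (this happens for n = 3), whereas for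
    t = -x the sum at 1/2 is strictly below 1, hence the open end at -1/2. *)
Lemma antiregular_neg_root (R : rcfType) (n : nat) :
  (2 <= n)%N -> (n %% 4 <> 2)%N ->
  (exists! x : R, x < 0 /\ root (degree_poly R (antiregular n)) x) /\
  (forall x : R, x < 0 -> root (degree_poly R (antiregular n)) x ->
     - 2 <= x < - (1 / 2)).
Proof.
move=> n2 n4.
suff [x [x0 rx xb uniq_x]] : exists x : R,
    [/\ x < 0, root (degree_poly R (antiregular n)) x, - 2 <= x < - (1 / 2) &
     forall y, y < 0 -> root (degree_poly R (antiregular n)) y -> x = y].
  by split=> [|y y0 /(uniq_x _ y0)<- //]; exists x; split=> // y [/uniq_x].
have [en|on] := boolP (odd n); last first.
  have [k [k0 ek ->]] : exists k, [/\ (0 < k)%N, ~~ odd k & n = k.*2].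
    by exists n./2; split; lia.
  exists (- 1); split; [lra| |lra|].
    by rewrite neg_root_antiregular_double ?eqxx //; lra.
  by move=> y y0; rewrite neg_root_antiregular_double // => /eqP.
have [k [k0 ->]] : exists k, (0 < k)%N /\ n = k.*2.+1.
  by exists n./2; split; lia.
have h0 : (0 : R) <= 2^-1 by lra.
have h1 : (2^-1 : R) <= 1 by lra.
have [ok|ek] := boolP (odd k).
  have [|t /andP[t0 t1] Et] := @expr_sum3_eq1 R k.*2 k.+1 k.
    have : (2^-1 : R) ^+ k.*2 <= 2^-1 ^+ 2 by apply: ler_wiXn2l => //; lia.
    have : (2^-1 : R) ^+ k.+1 <= 2^-1 ^+ 2 by apply: ler_wiXn2l => //; lia.
    have : (2^-1 : R) ^+ k <= 2^-1 ^+ 1 by apply: ler_wiXn2l => //; lia.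
    by lra.
  have tp : 0 < t by lra.
  have it1 : 1 <= t^-1 by rewrite invf_ge1.
  have it2 : t^-1 <= 2 by rewrite -[2]invrK lef_pV2 ?posrE; lra.
  exists (- t^-1); split; [lra| |lra|].
    rewrite neg_root_antiregular_double1_odd //; last by lra.
    by rewrite invrN opprK invrK Et.
  move=> y y0; rewrite neg_root_antiregular_double1_odd // => /eqP Ey.
  have iy : 0 <= - y^-1 by rewrite oppr_ge0 invr_le0 ltW.
  have -> : t = - y^-1.
    by apply: expr_sum3_inj (ltW tp) iy (etrans Et (esym Ey)); lia.
  by rewrite invrN opprK invrK.
have lt_half : (2^-1 : R) ^+ k.*2 + 2^-1 ^+ k + 2^-1 ^+ k.-1 < 1.
  have : (2^-1 : R) ^+ k.*2 <= 2^-1 ^+ 4 by apply: ler_wiXn2l => //; lia.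
  have : (2^-1 : R) ^+ k <= 2^-1 ^+ 2 by apply: ler_wiXn2l => //; lia.
  have : (2^-1 : R) ^+ k.-1 <= 2^-1 ^+ 1 by apply: ler_wiXn2l => //; lia.
  by lra.
have [t /andP[t0 t1] Et] := @expr_sum3_eq1 R _ _ _ (ltW lt_half).
have {t0} tp : 2^-1 < t.
  rewrite lt_neqAle t0 andbT; apply: contraTneq lt_half => ->.
  by rewrite Et ltxx.
exists (- t); split; [lra| |lra|].
  by rewrite neg_root_antiregular_double1_even ?opprK ?Et //; lra.
move=> y y0; rewrite neg_root_antiregular_double1_even // => /eqP Ey.
apply/eqP; rewrite eqr_oppLR; apply/eqP.
by apply: expr_sum3_inj (etrans Et (esym Ey)); [lia|lra|lra].
Qed.

(** * Limits of roots lie on the circle or at the origin *)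

(** Either z^k = 1 or z^(k-1) = -1 for a nonzero root z: the second factor of
    the closed form is z (z^(k-1) + 1).  For k = 1 that factor is 2 z and has
    no nonzero root. *)
Lemma antiregular_even_root_norm (C : numDomainType) (k : nat) (z : C) :
  (0 < k)%N -> root (degree_poly C (antiregular k.*2)) z ->
  z = 0 \/ `|z| = 1.
Proof.
move=> k0 rz; have [->|z0] := eqVneq z 0; first by left.
right; apply/eqP.
have := antiregular_even_factor C k z.
have := horner_degree_poly_antiregular C k.*2 z.
rewrite (eqP rz) mulr0 doubleK => <-; last by lia.
move/esym/eqP; rewrite mulf_eq0 subr_eq0 => /orP[/eqP zk|].
  by rewrite -(pexpr_eq1 k0) // -normrX zk normr1.
have -> : z ^+ k + z = z * (z ^+ k.-1 + 1).
  by rewrite mulrDr mulr1 -exprS prednK.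
rewrite mulf_eq0 (negPf z0) /= addr_eq0 => /eqP zk.
have [k1|k1] := posnP k.-1; last first.
  by rewrite -(pexpr_eq1 k1) // -normrX zk normrN normr1.
by move: zk => /eqP; rewrite k1 expr0 -addr_eq0 (eqr_nat _ 2 0).
Qed.

(** * Density of the roots near the circle *)

(** A quantitative form of the mean value property of log |P| on a disc free of
    roots.  Two antipodal points suffice: the error per root is quadratic in h,
    while the growth of log |P| across the circle is linear in h. *)
Lemma two_point_root_bound (C : numClosedFieldType) (P : {poly C}) (c h e : C) :
  0 < e -> (forall r, root P r -> e <= `|c - r|) ->
  `|P.[c + h]| * `|P.[c - h]| <=
    `|P.[c]| ^+ 2 * (1 + (`|h| / e) ^+ 2) ^+ (size P).-1.
Proof.
move=> e0 far; have [P0|P0] := eqVneq P 0.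
  by rewrite P0 !horner0 normr0 expr0n !mul0r.
have [s Es] := closed_field_poly_normal P.
have lc0 : lead_coef P != 0 by rewrite lead_coef_eq0.
have szP : (size P).-1 = size s.
  by rewrite Es size_scale // size_prod_XsubC.
have hornerP x : P.[x] = lead_coef P * \prod_(r <- s) (x - r).
  by rewrite {1}Es hornerZ horner_prod; under eq_bigr do rewrite hornerXsubC.
have {}far r : r \in s -> e <= `|c - r|.
  by move=> rs; apply: far; rewrite Es rootZ // root_prod_XsubC.
rewrite szP !hornerP !normrM mulrACA -expr2 exprMn -[leRHS]mulrA.
rewrite ler_wpM2l ?exprn_ge0 //.
rewrite !normr_prod -big_split /= -prodrXl.
have -> a : a ^+ size s = \prod_(r <- s) a.
  by rewrite big_const_seq count_predT iter_mulr_1.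
rewrite -big_split /= big_seq [leRHS]big_seq.
apply: ler_prod => r rs; rewrite mulr_ge0 //= -normrM.
have -> : (c + h - r) * (c - h - r) = (c - r) ^+ 2 - h ^+ 2 by ring.
apply: le_trans (ler_normB _ _) _; rewrite !normrX mulrDr mulr1 lerD2l.
rewrite -exprMn lerXn2r ?nnegrE ?mulr_ge0 ?invr_ge0 ?(ltW e0) //.
by rewrite mulrCA ler_peMr // ler_pdivlMr // mul1r far.
Qed.

Lemma ler_norm3 (R : numDomainType) (a b c : R) :
  `|a + b + c| <= `|a| + `|b| + `|c|.
Proof. by rewrite (le_trans (ler_normD _ _)) // lerD2r ler_normD. Qed.

(** The triangle inequality for the closed form, solved for three of its terms:
    D itself, bounded above inside the disc; the leading power, which dominates
    outside the disc; and the linear term, which dominates inside it. *)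
Lemma antiregular_horner_ub (C : numDomainType) (n : nat) (x : C) :
  (2 <= n)%N ->
  `|x - 1| * `|(degree_poly C (antiregular n)).[x]| <=
    `|x| ^+ n + `|x| + `|x - 1| * `|x| ^+ n./2.
Proof.
move=> n2; rewrite -normrM horner_degree_poly_antiregular //.
by rewrite -!normrX -normrM -[`|x|]normrN; exact: ler_norm3.
Qed.

Lemma antiregular_horner_lb_out (C : numDomainType) (n : nat) (x : C) :
  (2 <= n)%N ->
  `|x| ^+ n <= `|x - 1| * `|(degree_poly C (antiregular n)).[x]| + `|x|
    + `|x - 1| * `|x| ^+ n./2.
Proof.
move=> n2; rewrite -!normrX -!normrM horner_degree_poly_antiregular //.
rewrite -[`|(x - 1) * x ^+ _|]normrN.
apply: (le_trans _ (@ler_norm3 C _ _ _)).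
by rewrite addrAC addrK subrK.
Qed.

Lemma antiregular_horner_lb_in (C : numDomainType) (n : nat) (x : C) :
  (2 <= n)%N ->
  `|x| <= `|x - 1| * `|(degree_poly C (antiregular n)).[x]| + `|x| ^+ n
    + `|x - 1| * `|x| ^+ n./2.
Proof.
move=> n2; rewrite -!normrX -!normrM horner_degree_poly_antiregular //.
rewrite -[`|_ - _ + _|]normrN; apply: (le_trans _ (@ler_norm3 C _ _ _)).
by rewrite opprD opprB addrAC subrK subrK.
Qed.

Lemma size_degree_poly_antiregular (K : nzRingType) (n : nat) :
  (2 <= n)%N -> (size (degree_poly K (antiregular n)) <= n)%N.
Proof.
move=> n2; rewrite degree_poly_antiregular //.
apply: leq_trans (size_polyD _ _) _; rewrite geq_max size_polyXn.
apply/andP; split; last by lia.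
rewrite big_nat_cond; apply: (big_ind (fun p : {poly K} => size p <= n)%N).
- by rewrite size_poly0.
- by move=> p q pn qn; rewrite (leq_trans (size_polyD _ _)) // geq_max pn.
- by move=> i; rewrite size_polyXn; lia.
Qed.

(** Bernoulli's inequality and the archimedean property. *)
Lemma expr_eventually_gt (R : archiRealFieldType) (a b : R) : 1 < a ->
  exists n0 : nat, forall n, (n0 <= n)%N -> b < a ^+ n.
Proof.
move=> a1; have a0 : 0 < a by lra.
have bernoulli n : (a - 1) * n%:R < a ^+ n.
  elim: n => [|n IH]; first by rewrite mulr0 expr0.
  have an1 : 1 <= a ^+ n by rewrite exprn_ege1 // ltW.
  have : 0 <= (a - 1) * (a ^+ n - 1) by rewrite mulr_ge0 //; lra.
  by rewrite exprS -natr1; lra.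
exists (Num.bound (`|b| / (a - 1))) => n hn.
apply: le_lt_trans (bernoulli n).
apply: le_trans (ler_norm b) _; rewrite mulrC -ler_pdivrMr; last by lra.
apply: ltW; apply: lt_le_trans (archi_boundP _) _; last by rewrite ler_nat.
by rewrite divr_ge0 //; lra.
Qed.

Lemma expr_eventually_lt (R : archiRealFieldType) (a b : R) :
  0 < a < 1 -> 0 < b ->
  exists n0 : nat, forall n, (n0 <= n)%N -> a ^+ n < b.
Proof.
move=> /andP[a0 a1] b0.
have [|n0 H] := @expr_eventually_gt R a^-1 b^-1; first by rewrite invf_gt1.
by exists n0 => n /H; rewrite exprVn ltf_pV2 ?posrE // exprn_gt0.
Qed.

(** The norm of R[i] takes its values in R[i]; the estimates below need it as an
    element of the totally ordered field R. *)
Local Notation modulus := (@ComplexField.Normc.normc _).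

Lemma normr_modulus (R : rcfType) (x : R[i]%C) : (modulus x)%:C%C = `|x|.
Proof. by []. Qed.

Lemma modulusB (R : rcfType) (x y : R[i]%C) :
  modulus (x - y) <= modulus x + modulus y.
Proof. by rewrite -lecR rmorphD !normr_modulus; exact: ler_normB. Qed.

Lemma modulus_ge0 (R : rcfType) (x : R[i]%C) : 0 <= modulus x.
Proof. by case: x => a b; exact: sqrtr_ge0. Qed.

Lemma modulus_scale (R : rcfType) (w : R[i]%C) (a : R) :
  modulus w = 1 -> 0 <= a -> modulus (w * a%:C%C) = a.
Proof.
move=> w1 a0; rewrite ComplexField.Normc.normcM w1 mul1r /=.
by rewrite expr0n addr0 sqrtr_sqr ger0_norm.
Qed.

Lemma modulus_sub1 (R : rcfType) (x : R[i]%C) :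
  1 - modulus x <= modulus (x - 1) <= modulus x + 1.
Proof.
have := modulusB R x (x - 1); have := modulusB R x 1.
by rewrite subKr ComplexField.Normc.normc1 => h1 h2; apply/andP; split; lra.
Qed.

(** Dividing the closed form by x - 1 costs at most the inverse of the distance
    of x to the unit circle, uniformly in the direction of x. *)
Lemma antiregular_modulus_center (R : rcfType) (n : nat) (x : R[i]%C) :
  (2 <= n)%N -> modulus x <= 1 ->
  (1 - modulus x) * modulus (degree_poly R[i]%C (antiregular n)).[x] <= 4.
Proof.
move=> n2 x1.
have : modulus (x - 1) * modulus (degree_poly R[i]%C (antiregular n)).[x] <=
    modulus x ^+ n + modulus x + modulus (x - 1) * modulus x ^+ n./2.
  rewrite -lecR !(rmorphD, rmorphM, rmorphXn).
  exact: antiregular_horner_ub.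
have := modulus_sub1 R x.
have M0 := modulus_ge0 R (degree_poly R[i]%C (antiregular n)).[x].
have x0 := modulus_ge0 R x; have d0 := modulus_ge0 R (x - 1).
have xk k : 0 <= modulus x ^+ k <= 1 by rewrite exprn_ge0 // exprn_ile1.
have /andP[_] := xk n; have /andP[] := xk n./2.
move: x0 d0 M0 x1; clear.
move: (modulus x) (modulus (x - 1)) (modulus _.[x]) (_ ^+ n) (_ ^+ n./2).
move=> y d M yn ym y0 d0 M0 y1 ym0 ym1 yn1 /andP[dl du] ub.
have := ler_wpM2r M0 dl; have := ler_wpM2l d0 ym1; lra.
Qed.

(** Since |x - 1| <= 3, the two lower terms are at most 2 + 3 |x|^m, which is
    below half of |x|^(2m), hence of |x|^n, as soon as |x|^m is at least 10. *)
Lemma antiregular_modulus_outside (R : rcfType) (n : nat) (x : R[i]%C) :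
  (2 <= n)%N -> 1 <= modulus x <= 2 -> 10 <= modulus x ^+ n./2 ->
  modulus x ^+ n <= 6 * modulus (degree_poly R[i]%C (antiregular n)).[x].
Proof.
move=> n2 /andP[x1 x2] xm.
have : modulus x ^+ n <=
    modulus (x - 1) * modulus (degree_poly R[i]%C (antiregular n)).[x]
      + modulus x + modulus (x - 1) * modulus x ^+ n./2.
  rewrite -lecR !(rmorphD, rmorphM, rmorphXn).
  exact: antiregular_horner_lb_out.
have : modulus x ^+ n./2 * modulus x ^+ n./2 <= modulus x ^+ n.
  by rewrite -exprD ler_weXn2l //; lia.
have := modulus_sub1 R x.
have M0 := modulus_ge0 R (degree_poly R[i]%C (antiregular n)).[x].
move: M0 x1 x2 xm; clear.
move: (modulus x) (modulus (x - 1)) (modulus _.[x]) => y d M.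
move: (y ^+ n) (y ^+ n./2) => yn ym M0 y1 y2 ym10 /andP[_ d3] ymn lb.
have {}d3 : d <= 3 by lra.
have ym0 : 0 <= ym by lra.
have := ler_wpM2r M0 d3; have := ler_wpM2r ym0 d3.
by have := ler_wpM2r ym0 ym10; lra.
Qed.

(** Since |x - 1| <= 2, the terms other than the linear one are at most
    3 |x|^m, hence at most 1/4 under the hypothesis on |x|^m, while the linear
    term is at least 1/2. *)
Lemma antiregular_modulus_inside (R : rcfType) (n : nat) (x : R[i]%C) :
  (2 <= n)%N -> 2^-1 <= modulus x <= 1 -> modulus x ^+ n./2 <= 12^-1 ->
  1 <= 8 * modulus (degree_poly R[i]%C (antiregular n)).[x].
Proof.
move=> n2 /andP[x1 x2] xm.
have x0 := modulus_ge0 R x.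
have : modulus x <=
    modulus (x - 1) * modulus (degree_poly R[i]%C (antiregular n)).[x]
      + modulus x ^+ n + modulus (x - 1) * modulus x ^+ n./2.
  rewrite -lecR !(rmorphD, rmorphM, rmorphXn).
  exact: antiregular_horner_lb_in.
have : modulus x ^+ n <= modulus x ^+ n./2.
  by rewrite ler_wiXn2l //; lia.
have := modulus_sub1 R x.
have M0 := modulus_ge0 R (degree_poly R[i]%C (antiregular n)).[x].
have xm0 : 0 <= modulus x ^+ n./2 by rewrite exprn_ge0.
move: M0 xm0 x1 x2 xm; clear.
move: (modulus x) (modulus (x - 1)) (modulus _.[x]) => y d M.
move: (y ^+ n) (y ^+ n./2) => yn ym M0 ym0 y1 y2 ym12 /andP[_ d2] ymn lb.
have {}d2 : d <= 2 by lra.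
by have := ler_wpM2r M0 d2; have := ler_wpM2r ym0 d2; lra.
Qed.

Lemma two_point_root_modulus_bound (R : rcfType) (P : {poly R[i]%C})
    (c h : R[i]%C) (e : R) :
  0 < e -> (forall r, root P r -> e <= modulus (c - r)) ->
  modulus P.[c + h] * modulus P.[c - h] <=
    modulus P.[c] ^+ 2 * (1 + (modulus h / e) ^+ 2) ^+ (size P).-1.
Proof.
move=> e0 far; rewrite -lecR !(rmorphD, rmorphM, rmorphXn, fmorphV, rmorph1).
apply: (@two_point_root_bound _ P c h e%:C%C); first by rewrite ltcR.
by move=> r /far; rewrite -lecR.
Qed.

(** Eliminating A, B and M from the three bounds and the two-point inequality
    leaves y <= 48 (16 / t^2) g. *)
Lemma two_point_growth_absurd (R : realFieldType) (A B M t y g : R) :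
  0 < t -> 0 <= M -> 0 <= A -> 0 <= g ->
  t * M <= 4 -> y <= 6 * A -> 1 <= 8 * B ->
  A * B <= M ^+ 2 * g -> ~ (768 / t ^+ 2 * g < y).
Proof.
move=> t0 M0 A0 g0 Mub Alb Blb AB; apply/negP; rewrite -leNgt.
have Msq : M ^+ 2 <= 16 / t ^+ 2.
  rewrite ler_pdivlMr ?exprn_gt0 // -exprMn mulrC.
  rewrite (_ : 16 = 4 ^+ 2); last by ring.
  by apply: lerXn2r; rewrite ?nnegrE ?mulr_ge0 // ltW.
(* 768 = 6 * 8 * 16 collects the constants of the three bounds. *)
have -> : 768 / t ^+ 2 * g = 48 * (16 / t ^+ 2 * g) by ring.
by have := ler_wpM2r g0 Msq; have := ler_wpM2l A0 Blb; lra.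
Qed.

(** For c and h as in the introduction and y = 1 + t, the bounds
    |D(c)| <= 4 / t, y^n <= 6 |D(c + h)| and 1 <= 8 |D(c - h)| turn the two-point inequality
    into y^n <= 48 (16 / t^2) (1 + t / 2)^n, which fails for large n. *)
Lemma antiregular_root_near (R : realType) (w : R[i]%C) (e : R) :
  modulus w = 1 -> 0 < e ->
  exists n0 : nat, forall n, (n0 <= n)%N ->
    exists2 r, root (degree_poly R[i]%C (antiregular n)) r
      & modulus (w - r) < e.
Proof.
wlog e1 : e / e <= 1.
  move=> H w1 e0; have [e1|/ltW e1] := leP e 1; first exact: H.
  have [//|//|n0 Hn0] := H 1 _ w1; exists n0 => n /Hn0[r rr wr].
  by exists r => //; apply: lt_le_trans wr e1.
(* With c at distance t from w, roots at distance e from w are at distance at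
   least e / 2 from c, so the growth factor is 1 + (2 t / (e / 2))^2, which is
   1 + t / 2 for this t. *)
move=> w1 e0; pose t := e ^+ 2 / 32.
have t0 : 0 < t by rewrite divr_gt0 ?exprn_gt0.
have te : t <= e / 32 by rewrite ler_pM2r // expr2 ler_piMr // ltW.
have [n1 big_out] := @expr_eventually_gt R (1 + t) 10 ltac:(lra).
have [|n2 small_in] := @expr_eventually_lt R (1 - 3 * t) (12^-1) _ ltac:(lra).
  by apply/andP; split; lra.
have [|n3 ratio] :=
  @expr_eventually_gt R ((1 + t) / (1 + t / 2)) (768 / t ^+ 2).
  by rewrite ltr_pdivlMr; lra.
exists (2 + n1.*2 + n2.*2 + n3)%N => n hn.
have n2' : (2 <= n)%N by lia.
have {}big_out : 10 < (1 + t) ^+ n./2 by apply: big_out; lia.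
have {}small_in : (1 - 3 * t) ^+ n./2 < 12^-1 by apply: small_in; lia.
have {}ratio := ratio n ltac:(lia).
have [//|none] := pselect (exists2 r,
  root (degree_poly R[i]%C (antiregular n)) r & modulus (w - r) < e).
exfalso.
have far r :
    root (degree_poly R[i]%C (antiregular n)) r -> e <= modulus (w - r).
  by move=> rr; rewrite leNgt; apply/negP => wr; apply: none; exists r.
pose c := w * (1 - t)%:C%C; pose h := w * (2 * t)%:C%C.
have {far none} farc r :
    root (degree_poly R[i]%C (antiregular n)) r -> e / 2 <= modulus (c - r).
  move=> /far; have := modulusB R (c - r) (c - w).
  have -> : c - r - (c - w) = w - r by ring.
  have -> : c - w = w * (- t)%:C%C by rewrite /c rmorphB rmorphN rmorph1; ring.
  rewrite rmorphN mulrN normcN modulus_scale //; last exact: ltW.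
  by lra.
have e20 : 0 < e / 2 by lra.
have := two_point_root_modulus_bound R _ c h _ e20 farc.
have -> : c + h = w * (1 + t)%:C%C.
  by rewrite -mulrDr -rmorphD; congr (_ * _%:C%C); ring.
have -> : c - h = w * (1 - 3 * t)%:C%C.
  by rewrite -mulrBr -rmorphB; congr (_ * _%:C%C); ring.
rewrite [modulus h]modulus_scale //; last lra.
have ut : 1 + (2 * t / (e / 2)) ^+ 2 = 1 + t / 2.
  by rewrite {1}/t /t; field; rewrite gt_eqF.
rewrite {}ut; clearbody t.
have nc : modulus c = 1 - t by apply: modulus_scale => //; lra.
have sz : ((size (degree_poly R[i]%C (antiregular n))).-1 <= n)%N.
  apply: leq_trans (leq_pred _) _.
  exact: size_degree_poly_antiregular.
have h1 : 1 <= 1 + t / 2 by lra.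
have g0 : 0 < (1 + t / 2) ^+ n by apply: exprn_gt0; lra.
have Mub := antiregular_modulus_center R n c n2' ltac:(lra).
rewrite {}nc subKr in Mub.
have mout : modulus (w * (1 + t)%:C%C) = 1 + t.
  by apply: modulus_scale => //; lra.
have min : modulus (w * (1 - 3 * t)%:C%C) = 1 - 3 * t.
  by apply: modulus_scale => //; lra.
have := antiregular_modulus_outside R n (w * (1 + t)%:C%C) n2'.
rewrite {}mout => /(_ ltac:(lra) (ltW big_out)).
have := antiregular_modulus_inside R n (w * (1 - 3 * t)%:C%C) n2'.
rewrite {}min => /(_ ltac:(lra) (ltW small_in)).
move=> Blb Alb AB.
apply: (two_point_growth_absurd R _ _ _ _ ((1 + t) ^+ n) _ t0 _ _ (ltW g0) Mub
  Alb Blb _ _).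
- exact: modulus_ge0.
- exact: modulus_ge0.
- apply: le_trans AB _; apply: ler_wpM2l; first exact: sqr_ge0.
  exact: (ler_weXn2l h1 sz).
- by move: ratio; rewrite expr_div_n ltr_pdivlMr.
Qed.

(** * From nearby roots to convergent sequences of roots *)

Lemma exists_nearest_root (C : numClosedFieldType) (P : {poly C}) (w : C) :
  (1 < size P)%N ->
  exists2 r, root P r & forall r', root P r' -> `|w - r| <= `|w - r'|.
Proof.
move=> szP; have [s Es] := closed_field_poly_normal P.
have lc0 : lead_coef P != 0.
  by rewrite lead_coef_eq0; apply: contraTneq szP => ->; rewrite size_poly0.
have rootE r : root P r = (r \in s) by rewrite Es rootZ // root_prod_XsubC.
have szs : (0 < size s)%N.
  by move: szP; rewrite Es size_scale // size_prod_XsubC.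
have [i _ min_i] := @real_arg_minP C _ (Ordinal szs) xpredT
  (fun i => `|w - s`_i|) isT (fun _ _ => normr_real _).
exists s`_i => [|r]; rewrite rootE ?mem_nth // => rs.
rewrite -index_mem in rs; have := min_i (Ordinal rs) isT.
by rewrite /= nth_index // -index_mem.
Qed.

(** Choosing at each index a root nearest to z makes one sequence serve all
    tolerances e at once. *)
Lemma is_limit_of_roots_near (C : numClosedFieldType) (P : nat -> {poly C})
    (z : C) :
  (forall n, 1 < size (P n))%N ->
  (forall e, 0 < e -> exists n0 : nat, forall n, (n0 <= n)%N ->
     exists2 r, root (P n) r & `|z - r| < e) ->
  is_limit_of_roots P z.
Proof.
move=> szP near_z.
have nearest n : exists r,
    root (P n) r /\ forall r', root (P n) r' -> `|z - r| <= `|z - r'|.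
  by have [r] := exists_nearest_root C (P n) z (szP n); exists r.
have [z_ Hz] := choice nearest; exists z_; split=> [n|]; first by case: (Hz n).
apply/cvgrPdist_lt => e /near_z[n0 Hn0]; exists n0 => // n /= /Hn0[r rr].
by apply: le_lt_trans; case: (Hz n) => _; exact.
Qed.

Lemma root0_degree_poly_antiregular (K : idomainType) (n : nat) :
  (2 <= n)%N -> root (degree_poly K (antiregular n)) 0.
Proof.
move=> n2; rewrite root_degree_poly_antiregular // 1?eq_sym ?oner_eq0 //.
have n0 : (n == 0)%N = false by lia.
have m0 : (n./2 == 0)%N = false by lia.
by rewrite !expr0n n0 m0 subr0 mulr0 addr0.
Qed.

(** The value at 1 is the number of vertices. *)
Lemma degree_poly_antiregular_neq0 (K : numDomainType) (n : nat) :
  (0 < n)%N -> degree_poly K (antiregular n) != 0.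
Proof.
move=> n0; apply/eqP => /(congr1 (horner^~ 1)) /=.
rewrite horner0 /degree_poly horner_sum.
under eq_bigr do rewrite hornerXn expr1n.
by rewrite sumr_const card_ord => /eqP; rewrite pnatr_eq0; lia.
Qed.

Theorem proposition2p6 (R : realType) :
  (forall n : nat, (2 <= n)%N -> (n %% 4 <> 2)%N ->
     (exists! x : R, x < 0 /\ root (degree_poly R (antiregular n)) x) /\
     (forall x : R, x < 0 -> root (degree_poly R (antiregular n)) x ->
        - 2 <= x < - (1 / 2)))
  /\
  (forall z : R[i]%C,
     is_limit_of_roots (fun n => degree_poly R[i]%C (antiregular n.+2)) z
     <-> z = 0 \/ `|z| = 1).
Proof.
split=> [n n2 n4|z]; first exact: antiregular_neg_root.
split=> [[z_ [root_z cvg_z]]|].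
  have [->|z0] := eqVneq z 0; first by left.
  have [|z1] := eqVneq `|z| 1; first by right.
  move/cvgrPdist_lt: cvg_z => near_z.
  (* At a large index for which the number of vertices is even, the root is 0
     or on the circle, yet closer to z than both. *)
  have [|n1 _ Hn1] := near_z `|z|; first by rewrite normr_gt0.
  have [|n2 _ Hn2] := near_z `| `|z| - 1|; first by rewrite normr_gt0 subr_eq0.
  have /= lt1 := Hn1 (n1 + n2).*2 ltac:(rewrite /=; lia).
  have /= lt2 := Hn2 (n1 + n2).*2 ltac:(rewrite /=; lia).
  have := root_z (n1 + n2).*2; rewrite -doubleS.
  case/antiregular_even_root_norm => // [zn0|zn1].
    by rewrite zn0 subr0 ltxx in lt1.
  rewrite -zn1 in lt2; have := lt_le_trans lt2 (ler_dist_dist _ _).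
  by rewrite ltxx.
case=> [->|z1].
  exists (fun=> 0); split; last exact: cvg_cst.
  by move=> n; exact: root0_degree_poly_antiregular.
apply: is_limit_of_roots_near => [n|e e0].
  by apply: root_size_gt1 (root0_degree_poly_antiregular _ _ _) => //;
    exact: degree_poly_antiregular_neq0.
have z1' : modulus z = 1 by exact: (congr1 (@complex.Re R) z1).
have eE : e = (complex.Re e)%:C%C by rewrite RRe_real // gtr0_real.
have e0' : 0 < complex.Re e by rewrite -ltcR -eE.
have [n0 Hn0] := antiregular_root_near R z _ z1' e0'.
exists n0 => n hn; have [|r rr zr] := Hn0 n.+2; first by lia.
by exists r => //; rewrite eE; move: zr; rewrite -ltcR.
Qed.
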